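(* For all $\rho\in(0,1)$ $$\Psi(\rho)\ge\max\left\{\sqrt{\frac{2\rho}{1-\rho}},\ 1\right\},$$ where $$\Psi(\rho):=\sup_{Y:\,\beta(Y)\le\rho}\ \sup_{X}\ \Psi(X,Y),\qquad \Psi(X,Y):=\limsup_{\varepsilon\to0^+}\frac{\Phi^S(X,Y,\varepsilon)}{\sqrt{2\varepsilon}},$$ the suprema being taken over all real Banach spaces $Y$ with property $\beta$ with parameter $\rho$ and all real Banach spaces $X$.
   Context: All Banach spaces are real. $S_X$ denotes the unit sphere of $X$; $L(X,Y)$ is the space of bounded linear operators $X\to Y$ with the operator norm; $X^*=L(X,\mathbb{R})$. Property $\beta$: $Y$ has property $\beta$ with parameter $\rho$, $0\le\rho<1$ (written $\beta(Y)\le\rho$), if there are two sets $\{y_\alpha:\alpha\in\Lambda\}\subset S_Y$ and $\{y^*_\alpha:\alpha\in\Lambda\}\subset S_{Y^*}$ such that (i) $y^*_\alpha(y_\alpha)=1$ for all $\alpha$; (ii) $|y^*_\alpha(y_\gamma)|\le\rho$ whenever $\alpha\ne\gamma$; (iii) $\|y\|=\sup\{|y^*_\alpha(y)|:\alpha\in\Lambda\}$ for all $y\in Y$. Spherical Bishop-Phelps-Bollobás modulus: for $\varepsilon\in(0,1)$, $\Phi^S(X,Y,\varepsilon)$ is the infimum of those $\delta>0$ such that for every $(x,T)\in S_X\times S_{L(X,Y)}$ with $\|T(x)\|>1-\varepsilon$ there is $(z,F)\in S_X\times S_{L(X,Y)}$ with $\|F(z)\|=1$, $\|x-z\|<\delta$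 and $\|T-F\|<\delta$. *)

(* Defs.v *)
From HB Require Import structures.
From mathcomp Require Import all_boot all_order all_algebra.
From mathcomp Require Import all_classical all_reals all_analysis.

Set Implicit Arguments.
Unset Strict Implicit.
Unset Printing Implicit Defensive.

Import Order.TTheory GRing.Theory Num.Theory.
Import numFieldNormedType.Exports.

Local Open Scope classical_set_scope.
Local Open Scope ring_scope.

Definition unit_sphere (R : realType) (X : normedModType R) : set X :=
  [set x | `|x| = 1].

(* The supremum is over the closed unit ball, so that it is never over the
   empty set, even when X is the zero space. *)
Definition opnorm (R : realType) (X Y : normedModType R) (T : X -> Y) :
    \bar R :=
  ereal_sup [set (`|T x|)%:E | x in [set x : X | `|x| <= 1]].

Definition unit_sphere_L (R : realType) (X Y : normedModType R) :
    set {linear X -> Y} :=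
  [set T : {linear X -> Y} | continuous T /\ opnorm T = 1%E].

Definition property_beta (R : realType) (Y : completeNormedModType R)
    (rho : R) : Prop :=
  0 <= rho < 1 /\
  exists (Lambda : Type) (y : Lambda -> Y) (ys : Lambda -> {linear Y -> R^o}),
    [/\ forall a, unit_sphere (y a) /\ unit_sphere_L (ys a),
        forall a, ys a (y a) = 1,
        forall a c, a <> c -> `|ys a (y c)| <= rho
      & forall v : Y,
          (`|v|)%:E = ereal_sup [set (`|ys a v|)%:E | a in [set: Lambda]]].

Definition PhiS (R : realType) (X Y : completeNormedModType R) (eps : R) :
    \bar R :=
  ereal_inf [set delta%:E | delta in [set delta : R | 0 < delta /\
    forall (x : X) (T : {linear X -> Y}),
      unit_sphere x -> unit_sphere_L T -> 1 - eps < `|T x| ->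
      exists (z : X) (F : {linear X -> Y}),
        [/\ unit_sphere z, unit_sphere_L F, `|F z| = 1,
            `|x - z| < delta & (opnorm (T \- F)%R < delta%:E)%E]]].

(* PhiS is total in eps but only meaningful on (0, 1), which belongs to the
   filter 0^'+. *)
Definition PsiXY (R : realType) (X Y : completeNormedModType R) : \bar R :=
  limf_esup (fun eps : R => PhiS X Y eps / (Num.sqrt (2 * eps)%R)%:E)%E 0^'+.

Definition Psi (R : realType) (rho : R) : \bar R :=
  ereal_sup [set s | exists Y : completeNormedModType R,
    property_beta Y rho /\
    s = ereal_sup [set t | exists X : completeNormedModType R, t = PsiXY X Y]].

(* Main.v *)
(* The domain is the plane l_1^2, on which an operator T is a pair
   (u, v) = (T e1, T e2). For x = (1 - b) e1 + b e2, a vector z of norm 1 at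
   distance less than 2 b from x still lies strictly between e1 and e2, so an
   operator F of norm 1 attaining its norm at z maps e1 and e2 into a common
   face of the ball of Y. If ||T x|| >= 1 - a b although v has to move by c^2 a
   to reach a face met by a small perturbation of u, then 2 b = c^2 a gives
   Phi^S(eps) >= c sqrt(2 eps).
   For c = 1, Y = R, u = 1 and v = 1 - a do. For c > 1 take on R^3 the norm
   max(|v_0|, |v_1|, |v_2|, |g(v)|) with g(v) = sum w_i v_i,
   w_0 = 1/c^2, sum w_i = 1/rho, and u = (rho, rho, rho), v = (q, 1, 1) with
   g(v) = 1 - a. Then g(u) = 1 while u is interior to the other faces, and v can
   only reach g = 1 by increasing its coordinate 0 by a / w_0 = c^2 a. One needs
   q > -1, that is c^2 < 2 rho / (1 - rho), up to terms in a. *)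
Require Import Defs.
From HB Require Import structures.
From mathcomp Require Import all_boot all_order all_algebra.
From mathcomp Require Import all_classical all_reals all_analysis.
From mathcomp Require Import ring lra.

Import Order.TTheory GRing.Theory Num.Theory.
Import numFieldNormedType.Exports.
Local Open Scope classical_set_scope.
Local Open Scope ring_scope.

Set Implicit Arguments.
Unset Strict Implicit.
Unset Printing Implicit Defensive.

(** * Capped spaces: the sup norm enlarged by one more linear form *)

Lemma le_coord_rV (R : realType) n (v : 'rV[R]_n.+1) i : `|v 0 i| <= `|v|.
Proof.
rewrite [leRHS]/Num.norm/= mx_normrE.
by rewrite (le_trans _ (le_bigmax _ _ (0, i))).
Qed.

Lemma le_rV_norm (R : realType) n (v : 'rV[R]_n.+1) (M : R) :
  (forall i, `|v 0 i| <= M) -> `|v| <= M.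
Proof.
move=> vM; rewrite [leLHS]/Num.norm/= mx_normrE; apply: bigmax_le.
  exact: le_trans (normr_ge0 _) (vM 0).
by move=> -[k i] _ /=; rewrite ord1.
Qed.

(* R^(n+1) normed by the largest of the coordinates and of [cap_form]. *)
Definition capped (R : realType) (n : nat) (w : 'cV[R]_n.+1) : Type :=
  'rV[R]_n.+1.

Definition cap_form (R : realType) (n : nat) (w : 'cV[R]_n.+1)
    (v : capped w) : R := \sum_i v 0 i * w i 0.

Section Capped.
Context (R : realType) (n : nat) (w : 'cV[R]_n.+1).

HB.instance Definition _ := GRing.Lmodule.on (capped w).

Definition cap_norm (v : capped w) : R :=
  Num.max `|v : 'rV[R]_n.+1| `|cap_form v|.

Lemma cap_form_is_linear : linear (@cap_form R n w : capped w -> R^o).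
Proof.
move=> k u v; rewrite /cap_form scaler_sumr -big_split /=.
by apply: eq_bigr => i _; rewrite !mxE mulrDl -mulrA.
Qed.

HB.instance Definition _ :=
  GRing.isLinear.Build R (capped w) R^o *:%R (@cap_form R n w)
    cap_form_is_linear.

Lemma ler_cap_normD (u v : capped w) :
  cap_norm (u + v) <= cap_norm u + cap_norm v.
Proof.
rewrite /cap_norm ge_max linearD; apply/andP; split.
  by apply: le_trans (ler_normD _ _) _; rewrite lerD ?le_max ?lexx ?orbT.
by apply: le_trans (ler_normD _ _) _; rewrite lerD ?le_max ?lexx ?orbT.
Qed.

Lemma cap_normZ (l : R) (v : capped w) : cap_norm (l *: v) = `|l| * cap_norm v.
Proof.
by rewrite /cap_norm linearZ/= normrM [in LHS]normrZ maxr_pMr.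
Qed.

Lemma cap_norm0_eq0 (v : capped w) : cap_norm v = 0 -> v = 0.
Proof.
move=> v0; apply/eqP; rewrite -(@normr_le0 _ ('rV[R]_n.+1)) -v0.
by rewrite le_max lexx.
Qed.

HB.instance Definition _ := Lmodule_isNormed.Build R (capped w)
  ler_cap_normD cap_normZ cap_norm0_eq0.

Lemma cap_normE (v : capped w) :
  `|v| = Num.max `|v : 'rV[R]_n.+1| `|cap_form v|.
Proof. by []. Qed.

Lemma le_norm_cap (v : capped w) : `|v : 'rV[R]_n.+1| <= `|v|.
Proof. by rewrite cap_normE le_max lexx. Qed.

Lemma cap_norm_le (v : capped w) :
  `|v| <= (1 + \sum_i `|w i 0|) * `|v : 'rV[R]_n.+1|.
Proof.
have s0 : 0 <= \sum_i `|w i 0| by apply: sumr_ge0.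
rewrite cap_normE ge_max ler_peMl ?lerDl//=.
rewrite mulrDl mul1r -[leLHS]add0r lerD// mulr_suml.
apply: le_trans (ler_norm_sum _ _ _) _; apply: ler_sum => i _.
by rewrite normrM mulrC ler_wpM2l// le_coord_rV.
Qed.

(** The capped norm and the sup norm are equivalent, so a sup-norm limit is also a limit here. *)
Lemma cap_complete (F : set_system (capped w)) :
  ProperFilter F -> cauchy F -> cvg F.
Proof.
move=> FF /cauchy_ballP Fc.
have : cauchy (F : set_system 'rV[R]_n.+1).
  apply/cauchy_ballP => e e0; have := Fc _ e0.
  apply: filterS => -[x y]; rewrite -!ball_normE /ball_/= => xy.
  exact: le_lt_trans (le_norm_cap (x - y)) xy.
move=> /cauchy_cvg /cvg_ex[l Fl].
apply/cvg_ex; exists (l : capped w); apply/cvgrPdist_lt => e e0.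
have s0 : 0 < 1 + \sum_i `|w i 0| by rewrite ltr_wpDr// sumr_ge0.
have /cvgrPdist_lt /(_ (e / (1 + \sum_i `|w i 0|))) := Fl.
rewrite divr_gt0// => /(_ isT); apply: filterS => x.
rewrite ltr_pdivlMr// mulrC => lx; exact: le_lt_trans (cap_norm_le _) lx.
Qed.

HB.instance Definition _ := Uniform_isComplete.Build (capped w) cap_complete.

End Capped.

(** * Norms of operators *)

Section Operators.
Context (R : realType) (X Y : normedModType R).

Lemma opnorm_le (T : {linear X -> Y}) (M : R) (x : X) :
  (opnorm T <= M%:E)%E -> `|x| <= 1 -> `|T x| <= M.
Proof.
move=> TM x1; rewrite -lee_fin; apply: le_trans TM.
by apply: ereal_sup_ubound; exists x.
Qed.

Lemma opnorm_sub_lt (T F : {linear X -> Y}) (d : R) (x : X) :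
  (opnorm (T \- F)%R < d%:E)%E -> `|x| <= 1 -> `|T x - F x| < d.
Proof.
move=> TFd x1; rewrite -lte_fin; apply: le_lt_trans TFd.
by apply: ereal_sup_ubound; exists x.
Qed.

Lemma unit_sphere_LP (T : {linear X -> Y}) (x : X) :
  (forall y, `|T y| <= `|y|) -> `|x| <= 1 -> `|T x| = 1 -> unit_sphere_L T.
Proof.
move=> T1 x1 Tx; split.
  move=> y; apply/cvgrPdist_lt => e e0.
  have /cvgrPdist_lt/(_ e e0) := @cvg_id _ (nbhs y).
  by apply: filterS => z; rewrite -linearB; exact: le_lt_trans (T1 _).
apply/eqP; rewrite eq_le; apply/andP; split.
  by apply: ge_ereal_sup => _ [y /= y1 <-]; rewrite lee_fin (le_trans (T1 y)).
by apply: ereal_sup_ubound; exists x => //; rewrite Tx.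
Qed.

End Operators.

(** * Property beta of the range spaces *)

Section CappedBeta.
Context (R : realType) (n : nat) (w : 'cV[R]_n.+1).

Definition coord_form (i : 'I_n.+1) (v : capped w) : R := v 0 i.

Lemma coord_form_is_linear i : linear (coord_form i : capped w -> R^o).
Proof. by move=> k u v; rewrite /coord_form !mxE. Qed.

HB.instance Definition _ i :=
  GRing.isLinear.Build R (capped w) R^o *:%R (coord_form i)
    (coord_form_is_linear i).

Definition cap_forms (a : option 'I_n.+1) : {linear capped w -> R^o} :=
  if a is Some i then coord_form i else @cap_form R n w.

Lemma le_cap_forms (v : capped w) a : `|cap_forms a v| <= `|v|.
Proof.
rewrite cap_normE le_max.
by case: a => [i|] /=; rewrite ?le_coord_rV ?lexx ?orbT.
Qed.

Lemma cap_forms_attain (v : capped w) : exists a, `|v| = `|cap_forms a v|.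
Proof.
rewrite cap_normE.
have [_|_] := leP `|cap_form v| `|v : 'rV[R]_n.+1|; last first.
  by exists None.
have [|[k i] _ vi] := @eq_bigmax _ R _ 0 (0, 0) predT
  (fun ij : 'I_1 * 'I_n.+1 => `|(v : 'rV[R]_n.+1) ij.1 ij.2|) isT => //.
by exists (Some i); rewrite [LHS]/Num.norm/= mx_normrE vi/= ord1.
Qed.

Lemma cap_norm_sup (v : capped w) :
  (`|v|)%:E =
  ereal_sup [set (`|cap_forms a v|)%:E | a in [set: option 'I_n.+1]].
Proof.
apply/eqP; rewrite eq_le; apply/andP; split.
  by have [a ->] := cap_forms_attain v; apply: ereal_sup_ubound; exists a.
by apply: ge_ereal_sup => _ [a _ <-]; rewrite lee_fin le_cap_forms.
Qed.

Lemma cap_norm_eq1 (v : capped w) a :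
  (forall c, `|cap_forms c v| <= 1) -> `|cap_forms a v| = 1 -> `|v| = 1.
Proof.
move=> v1 va; apply/eqP; rewrite eq_le -{2}va le_cap_forms andbT.
by have [c ->] := cap_forms_attain v.
Qed.

(** The sum of the weights makes [cap_form] equal to 1 at the constant vector [rho]. The bounds on
    [w i 0] say exactly that (1 + rho) w_i - 1, the value of [cap_form] at the point paired with
    coordinate i, lies in [-rho, rho]. *)
Lemma property_beta_capped (rho : R) :
  0 < rho < 1 -> \sum_i w i 0 = rho^-1 ->
  (forall i, (1 - rho) / (1 + rho) <= w i 0 <= 1) ->
  property_beta (capped w) rho.
Proof.
move=> /andP[r0 r1] ws wi; split; first by rewrite ltW.
pose y (a : option 'I_n.+1) : capped w :=
  if a is Some i then \row_j (if j == i then 1 else - rho) else const_mx rho.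
have yy a : cap_forms a (y a) = 1.
  case: a => [i|]; first by rewrite /= /coord_form mxE eqxx.
  rewrite /= /cap_form; under eq_bigr do rewrite mxE.
  by rewrite -mulr_sumr ws mulfV ?gt_eqF.
have yc a c : a <> c -> `|cap_forms a (y c)| <= rho.
  case: a => [i|]; case: c => [j|]//= ac.
  - rewrite /coord_form mxE ifF; last by apply/eqP => ij; apply: ac; rewrite ij.
    by rewrite normrN gtr0_norm.
  - by rewrite /coord_form mxE gtr0_norm.
  - have -> : cap_form (y (Some j)) = (1 + rho) * w j 0 - 1.
      rewrite /cap_form (bigD1 j)//= mxE eqxx mul1r.
      under eq_bigr => i ij do rewrite mxE (negbTE ij).
      rewrite -mulr_sumr.
      have -> : \sum_(i | i != j) w i 0 = rho^-1 - w j 0.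
        by rewrite -ws [in RHS](bigD1 j)//= addrAC subrr add0r.
      by field; rewrite gt_eqF.
    have r0' : 0 < 1 + rho by rewrite addr_gt0.
    have /andP[] := wi j; rewrite ler_pdivrMr// => w1 w2.
    by rewrite ler_norml; apply/andP; split; nra.
have y1 a : `|y a| = 1.
  apply: (@cap_norm_eq1 _ a); last by rewrite yy normr1.
  move=> c; have [->|/yc] := pselect (c = a); first by rewrite yy normr1.
  by move=> /le_trans; apply; exact: ltW.
exists (option 'I_n.+1), y, cap_forms; split => //.
- move=> a; split; first exact: y1.
  apply: (@unit_sphere_LP _ _ _ _ (y a)); last by rewrite yy normr1.
  + by move=> v; exact: le_cap_forms.
  + by rewrite y1.
- exact: cap_norm_sup.
Qed.

End CappedBeta.

(** A single pair suffices, which makes the condition on distinct indices vacuous. *)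
Lemma property_beta_real (R : realType) (rho : R) :
  0 < rho < 1 -> property_beta R^o rho.
Proof.
move=> /andP[r0 r1]; split; first by rewrite ltW.
exists unit, (fun=> 1), (fun=> idfun); split => //=.
- move=> _; split; first exact: normr1.
  by apply: (@unit_sphere_LP _ R^o R^o idfun 1) => //=; rewrite normr1.
- by case; case.
- move=> v; rewrite (_ : [set _ | _ in _] = [set (`|v|)%:E]) ?ereal_sup1//.
  by apply/seteqP; split => [_ [_ _ <-]//|_ ->]; exists tt.
Qed.

(* The library makes matrices normed and complete without declaring the join. *)
HB.instance Definition _ (R : realType) (m n : nat) :=
  Complete.on 'M[R]_(m, n).

(* The point s e1 + t e2 of l_1^2, realized in the sup-normed plane by
   e1 = (1, 1) and e2 = (1, -1). *)
Definition l1pt (R : realType) (s t : R) : 'rV[R]_2 :=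
  \row_j (if j == 0 then s + t else s - t).

(** * The plane l_1^2 and the operators on it *)

Section L1Plane.
Context (R : realType).
Implicit Types (s t : R) (x : 'rV[R]_2).

Lemma l1ptP x : x = l1pt ((x 0 0 + x 0 1) / 2) ((x 0 0 - x 0 1) / 2).
Proof.
apply/rowP => i; rewrite mxE; have [->|] := eqVneq i 0; first by field.
case: i => [[|[|//]]] // lti _.
rewrite (_ : Ordinal lti = 1); last exact: val_inj.
by field.
Qed.

(** The larger of |s + t| and |s - t| is |s| + |t|. *)
Lemma norm_l1pt s t : `|l1pt s t| = `|s| + `|t|.
Proof.
apply/eqP; rewrite eq_le; apply/andP; split.
  apply: le_rV_norm => i; rewrite mxE; case: ifP => _; first exact: ler_normD.
  exact: ler_normB.
have := le_coord_rV (l1pt s t) 0; rewrite mxE/=.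
have := le_coord_rV (l1pt s t) 1; rewrite mxE/=.
have [s0|s0] := lerP 0 s; have [t0|t0] := lerP 0 t;
  rewrite ?(ger0_norm s0) ?(ltr0_norm s0) ?(ger0_norm t0) ?(ltr0_norm t0).
all: rewrite !ler_norml; lra.
Qed.

Lemma l1ptE s t : l1pt s t = s *: l1pt 1 0 + t *: l1pt 0 1.
Proof.
by apply/rowP => i; rewrite !mxE; case: ifP => _; ring.
Qed.

Lemma l1ptB s t s' t' : l1pt s t - l1pt s' t' = l1pt (s - s') (t - t').
Proof. by apply/rowP => i; rewrite !mxE; case: ifP => _; ring. Qed.

Context (Y : normedModType R).
Implicit Types u v : Y.

(** The two coefficients are the coordinates of [x] along e1 and e2. *)
Definition l1op u v x : Y :=
  ((x 0 0 + x 0 1) / 2) *: u + ((x 0 0 - x 0 1) / 2) *: v.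

Lemma l1op_is_linear u v : linear (l1op u v).
Proof.
move=> k x y; rewrite /l1op !mxE scalerDr !scalerA [RHS]addrACA -!scalerDl.
by congr (_ *: _ + _ *: _); field.
Qed.

HB.instance Definition _ u v :=
  GRing.isLinear.Build R 'rV[R]_2 Y *:%R (l1op u v) (l1op_is_linear u v).

Lemma l1op_l1pt u v s t : l1op u v (l1pt s t) = s *: u + t *: v.
Proof. by rewrite /l1op !mxE /=; congr (_ *: _ + _ *: _); field. Qed.

Lemma unit_sphere_L_l1op u v :
  `|u| = 1 -> `|v| <= 1 -> unit_sphere_L (l1op u v).
Proof.
move=> u1 v1; apply: (@unit_sphere_LP _ _ _ _ (l1pt 1 0)).
- move=> x; rewrite {2}[x]l1ptP norm_l1pt.
  apply: le_trans (ler_normD _ _) _.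
  by rewrite !normrZ u1 mulr1 lerD2l ler_piMr.
- by rewrite norm_l1pt normr1 normr0 addr0.
- by rewrite /= l1op_l1pt scale1r scale0r addr0.
Qed.

End L1Plane.

(** * From a gap between faces to a lower bound on the modulus *)

Section ModulusLowerBound.
Context (R : realType) (Y : completeNormedModType R) (c a0 : R).
Hypotheses (c0 : 0 < c) (a00 : 0 < a0).

(* The last two conditions say that T x is nearly of norm 1 for (e1, e2) sent to
   (u, v), but that v is at distance at least c^2 a from every face of the ball
   that is met near u. *)
Definition face_gap := forall a : R, 0 < a < a0 -> exists u v : Y,
  [/\ `|u| = 1, `|v| <= 1,
      forall b, 0 <= b <= 1 -> 1 - a * b <= `|(1 - b) *: u + b *: v|
    & forall u' v' t, 0 < t < 1 -> `|u'| <= 1 -> `|v'| <= 1 ->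
        `|(1 - t) *: u' + t *: v'| = 1 ->
        `|u - u'| < c ^+ 2 * a -> c ^+ 2 * a <= `|v - v'|].

Lemma PhiS_ge (eps : R) : face_gap -> 0 < eps ->
  Num.sqrt (2 * eps) < c * a0 -> c * Num.sqrt (2 * eps) <= 2^-1 ->
  ((c * Num.sqrt (2 * eps))%:E <= PhiS 'rV[R]_2 Y eps)%E.
Proof.
move=> gap e0 ea0 e12; apply: le_ereal_inf_tmp => _ [d [d0 Hd] <-].
rewrite lee_fin leNgt; apply/negP => de.
have s0 : 0 <= Num.sqrt (2 * eps) by exact: sqrtr_ge0.
have sE : Num.sqrt (2 * eps) ^+ 2 = 2 * eps.
  by rewrite sqr_sqrtr// mulr_ge0// ltW.
have c20 : 0 < c ^+ 2 by rewrite exprn_gt0.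
(* Both the gap c^2 a and the critical radius 2 b equal [d]. Then a b = d^2 / (2 c^2), which is
   below [eps] because d < c sqrt(2 eps). *)
pose a := d / c ^+ 2; pose b := d / 2.
have aE : c ^+ 2 * a = d by rewrite /a mulrC divfK// gt_eqF.
have bE : d = 2 * b by rewrite /b; field.
have b4 : b < 4^-1 by lra.
have b0 : 0 < b by lra.
have [|u [v [u1 v1 uv far]]] := gap a.
  rewrite divr_gt0//= ltr_pdivrMr// (lt_trans de)// expr2 mulrCA ltr_pM2l//.
  by rewrite [ltRHS]mulrC.
have ab : a * b < eps.
  rewrite /a /b mulrACA -expr2 -invfM ltr_pdivrMr ?mulr_gt0//.
  rewrite (_ : eps * _ = (c * Num.sqrt (2 * eps)) ^+ 2); last first.
    by rewrite exprMn sE; ring.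
  by rewrite ltr_pXn2r ?nnegrE ?mulr_ge0// ltW.
have [||z [F [z1 [_ F1] Fz xz TF]]] :=
    Hd (l1pt (1 - b) b) (l1op u v) _ (unit_sphere_L_l1op u1 v1).
- by rewrite /unit_sphere/= norm_l1pt !ger0_norm//; lra.
- rewrite /= l1op_l1pt; apply: lt_le_trans (uv b _).
    by rewrite ltrD2l ltrN2.
  by apply/andP; split; lra.
have F1' x : `|x| <= 1 -> `|F x| <= 1 by apply: opnorm_le; rewrite F1.
have TF' x : `|x| <= 1 -> `|l1op u v x - F x| < d by exact: opnorm_sub_lt.
move: z1 Fz xz; rewrite [z]l1ptP.
set s := (X in l1pt X _); set t := (X in l1pt _ X).
rewrite /unit_sphere/= l1ptB !norm_l1pt => st Fst xst.
(* If t <= 0, the distance from [x] to [z] would be at least 2 b; s <= 0 is excluded by b < 1/4. *)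
have [t0 t1 sE'] : [/\ 0 < t, t < 1 & s = 1 - t].
  move: st xst; rewrite bE.
  have [s0'|s0'] := lerP 0 s; have [t0'|t0'] := lerP 0 t;
    rewrite ?(ger0_norm s0') ?(ltr0_norm s0') ?(ger0_norm t0') ?(ltr0_norm t0');
  have := ler_norm (1 - b - s); have := ler_norm (b - t);
  have := ler_norm (- (1 - b - s)); have := ler_norm (- (b - t));
  rewrite !normrN; move=> ? ? ? ? ? ?; split; lra.
have e1 : `|l1pt 1 0 : 'rV[R]_2| <= 1 by rewrite norm_l1pt normr1 normr0 addr0.
have e2 : `|l1pt 0 1 : 'rV[R]_2| <= 1 by rewrite norm_l1pt normr1 normr0 add0r.
(* F z is a convex combination of F e1 and F e2 of norm 1, and F e1 is within [d] of [u]; so F e2 is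
   at least [d] away from [v], against |T - F| < d. *)
have := far (F (l1pt 1 0)) (F (l1pt 0 1)) t.
rewrite t0 t1 !F1'// aE -sE' -!linearZ -linearD -l1ptE Fst.
have := TF' _ e1; rewrite l1op_l1pt scale1r scale0r addr0 => ->.
move=> /(_ isT isT isT erefl isT).
have := TF' _ e2; rewrite l1op_l1pt scale1r scale0r add0r.
by rewrite ltNge => /negP.
Qed.

Lemma PsiXY_ge : face_gap -> (c%:E <= PsiXY 'rV[R]_2 Y)%E.
Proof.
move=> gap; rewrite /PsiXY limf_esupE; apply: le_ereal_inf_tmp => _ [V FV <-].
(* The two smallness conditions of [PhiS_ge], as bounds on sqrt(2 e). *)
pose m := Num.min (c * a0) (2 * c)^-1.
have m0 : 0 < m by rewrite lt_min mulr_gt0//= invr_gt0 mulr_gt0.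
have [e [Ve e0 em]] : exists e, [/\ V e, 0 < e & e < m ^+ 2 / 2].
  have : \forall e \near 0^'+, [/\ V e, 0 < e & e < m ^+ 2 / 2].
    near=> e; split; first by near: e; exact: FV.
    - by near: e; exact: nbhs_right_gt.
    - by near: e; apply: nbhs_right_lt; rewrite divr_gt0// exprn_gt0.
  by move=> /filter_ex.
have sm : Num.sqrt (2 * e) < m.
  have := sqrtr_sqr m; rewrite (gtr0_norm m0) => <-.
  by rewrite ltr_sqrt ?exprn_gt0//; lra.
have s0 : 0 < Num.sqrt (2 * e) by rewrite sqrtr_gt0 mulr_gt0.
apply: le_ereal_sup_tmp; exists (PhiS 'rV[R]_2 Y e / (Num.sqrt (2 * e))%:E)%E.
  by exists e.
rewrite inver gt_eqF// lee_pdivlMr// -EFinM; apply: PhiS_ge => //.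
- by move: sm; rewrite lt_min => /andP[].
- move: sm; rewrite lt_min => /andP[_ /ltW].
  by rewrite invfM ler_pdivlMr// [leLHS]mulrC.
Unshelve. all: by end_near. Qed.

End ModulusLowerBound.

(** * Face gaps in the line and in capped spaces *)

(** 1 and -1 are extreme points of [-1, 1]. Applied to the values of a norming form, this puts two
    vectors on a common face. *)
Lemma convex_comb_norm1 (R : realType) (p q t : R) :
  0 < t < 1 -> `|p| <= 1 -> `|q| <= 1 -> `|(1 - t) * p + t * q| = 1 ->
  q = p /\ `|p| = 1.
Proof.
move=> /andP[t0 t1]; rewrite !ler_norml => /andP[p1 p2] /andP[q1 q2].
have [_ h|_ h] := ger0P ((1 - t) * p + t * q).
  have -> : p = 1 by apply/eqP; rewrite eq_le; apply/andP; split; nra.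
  have -> : q = 1 by apply/eqP; rewrite eq_le; apply/andP; split; nra.
  by rewrite normr1.
have -> : p = -1 by apply/eqP; rewrite eq_le; apply/andP; split; nra.
have -> : q = -1 by apply/eqP; rewrite eq_le; apply/andP; split; nra.
by rewrite normrN1.
Qed.

Lemma face_gap_real (R : realType) : face_gap R^o 1 1.
Proof.
move=> a /andP[a0 a1]; exists 1, (1 - a); split.
- exact: normr1.
- by rewrite ger0_norm; lra.
- move=> b /andP[b0 b1]; rewrite /GRing.scale/= ger0_norm; first by lra.
  by nra.
- move=> u' v' t t01 u1 v1; rewrite /GRing.scale/=.
  move=> /(convex_comb_norm1 t01 u1 v1)[-> nu1].
  rewrite expr1n mul1r => uu.
  have -> : u' = 1.
    move: nu1 uu; have [_ ->//|_ u'1] := ger0P u'.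
    by rewrite ltr_norml => /andP[]; lra.
  by rewrite addrAC subrr add0r normrN gtr0_norm.
Qed.

Lemma face_gap_capped (R : realType) n (w : 'cV[R]_n.+1) (rho c : R) :
  0 < rho < 1 -> 0 < c -> \sum_i w i 0 = rho^-1 -> (forall i, 0 <= w i 0) ->
  w 0 0 = (c ^+ 2)^-1 -> (1 - rho) / rho < 2 * w 0 0 ->
  exists2 a0, 0 < a0 & face_gap (capped w) c a0.
Proof.
move=> /andP[r0 r1] c0 ws w0 wc wr.
have w00 : 0 < w 0 0 by rewrite wc invr_gt0 exprn_gt0.
have c2w : c ^+ 2 * w 0 0 = 1 by rewrite wc mulfV// gt_eqF// exprn_gt0.
have wK x : c ^+ 2 * (w 0 0 * x) = x by rewrite mulrA c2w mul1r.
have ws' : \sum_(i | i != 0) w i 0 = rho^-1 - w 0 0.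
  by rewrite -ws [in RHS](bigD1 0)//= addrAC subrr add0r.
(* The three bounds give, in order, q > -1, c^2 a < 1 - rho and c^2 a < rho. *)
pose a0 := Num.min (2 * w 0 0 - (1 - rho) / rho)
  (Num.min (w 0 0 * (1 - rho)) (w 0 0 * rho)).
exists a0; first by rewrite !lt_min subr_gt0 wr !mulr_gt0// subr_gt0.
move=> a /andP[a_gt0]; rewrite !lt_min => /and3P[aw ar1 ar].
have a1 : c ^+ 2 * a < 1 - rho by rewrite -[ltRHS]wK ltr_pM2l// exprn_gt0.
have a2 : c ^+ 2 * a < rho by rewrite -[ltRHS]wK ltr_pM2l// exprn_gt0.
(* The solution of w_0 q + (1/rho - w_0) = 1 - a. *)
pose q := 1 - c ^+ 2 * (a + (1 - rho) / rho).
pose u : capped w := const_mx rho.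
pose v : capped w := \row_j (if j == 0 then q else 1).
have rE : (1 - rho) / rho = rho^-1 - 1 by field; rewrite gt_eqF.
have qw : w 0 0 * q = w 0 0 - (a + (1 - rho) / rho).
  by rewrite /q mulrBr mulr1 mulrCA wK.
have gu : cap_form u = 1.
  rewrite /cap_form; under eq_bigr do rewrite mxE.
  by rewrite -mulr_sumr ws mulfV ?gt_eqF.
have gv : cap_form v = 1 - a.
  rewrite /cap_form (bigD1 0)//= mxE eqxx mulrC qw.
  under eq_bigr => i i0 do rewrite mxE (negbTE i0) mul1r.
  by rewrite ws' rE; ring.
exists u, v; split.
- apply: (@cap_norm_eq1 _ _ _ _ None); last by rewrite /= gu normr1.
  case=> [i|] /=; last by rewrite gu normr1.
  by rewrite /coord_form mxE gtr0_norm// ltW.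
- have [[i|] ->] := cap_forms_attain v; rewrite /= ?gv; last first.
    have rr : w 0 0 <= rho^-1 by rewrite -subr_ge0 -ws' sumr_ge0.
    have : w 0 0 * rho <= 1 by rewrite -ler_pdivlMr// div1r.
    by rewrite ler_norml => ?; apply/andP; split; lra.
  rewrite /coord_form mxE; case: ifP => _; last by rewrite normr1.
  have rr0 : 0 < (1 - rho) / rho by rewrite divr_gt0// subr_gt0.
  by rewrite ler_norml; apply/andP; split; rewrite -(ler_pM2l w00) qw; lra.
- move=> b b01; apply: le_trans (le_cap_forms _ None).
  rewrite /= linearD !linearZ/= gu gv /GRing.scale/=.
  by apply: le_trans (ler_norm _); lra.
- move=> u' v' t t01 u'1 v'1 uv1 uu'.
  have [f fE] := cap_forms_attain ((1 - t) *: u' + t *: v').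
  move: fE; rewrite uv1 linearD !linearZ/= => /esym.
  move=> /(convex_comb_norm1 t01 (le_trans (le_cap_forms _ _) u'1)
    (le_trans (le_cap_forms _ _) v'1))[fv fu].
  have ui i : `|rho - u' 0 i| < c ^+ 2 * a.
    apply: le_lt_trans uu'; have := le_cap_forms (u - u') (Some i).
    by rewrite /= /coord_form !mxE.
  (* No coordinate face is met: |u'_i| < rho + c^2 a < 1. *)
  case: f => [i|] in fv fu.
    have := ui i; move: fu; rewrite /= /coord_form => fu.
    have := ler_normB rho (rho - u' 0 i).
    by rewrite opprB addrC subrK fu (gtr0_norm r0); lra.
  (* Since c^2 a < rho, [u'] has nonnegative coordinates, which rules out the face where [cap_form]
     is -1. *)
  have gu'0 : 0 <= cap_form u'.
    apply: sumr_ge0 => i _; rewrite mulr_ge0//.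
    by have := ui i; rewrite ltr_norml => /andP[]; lra.
  move: fv fu; rewrite /= ger0_norm// => gv' gu'1.
  have v'i i : v' 0 i <= 1.
    exact: le_trans (ler_norm _) (le_trans (le_cap_forms _ (Some i)) v'1).
  (* The other coordinates of [v'] contribute at most 1/rho - w_0, so v'_0 - q >= a / w_0 = c^2
     a. *)
  have : 1 <= w 0 0 * v' 0 0 + (rho^-1 - w 0 0).
    rewrite -gu'1 -gv' /cap_form (bigD1 0)//= -ws' [w 0 0 * _]mulrC lerD2l.
    by apply: ler_sum => i _; rewrite ler_piMl.
  have := le_cap_forms (v - v') (Some 0).
  rewrite /= /coord_form !mxE eqxx => /(le_trans _) vv' gap; apply: vv'.
  rewrite distrC; apply: le_trans (ler_norm _).
  by rewrite -(ler_pM2l w00) mulrBr qw mulrCA wK rE; lra.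
Qed.

(** * Choice of the weights and conclusion *)

Lemma Psi_ge (R : realType) (rho c : R) (X Y : completeNormedModType R) :
  property_beta Y rho -> (c%:E <= PsiXY X Y)%E -> (c%:E <= Psi rho)%E.
Proof.
move=> betaY cXY; apply: le_ereal_sup_tmp.
exists (ereal_sup [set t | exists X : completeNormedModType R, t = PsiXY X Y]).
  by exists Y.
by apply: le_ereal_sup_tmp; exists (PsiXY X Y) => //; exists X.
Qed.

Lemma Psi_ge1 (R : realType) (rho : R) : 0 < rho < 1 -> (1%:E <= Psi rho)%E.
Proof.
move=> rho01; apply: (Psi_ge (property_beta_real rho01)).
exact: (@PsiXY_ge _ _ _ 1) (@face_gap_real R).
Qed.

Lemma Psi_ge_sqr (R : realType) (rho c : R) : 0 < rho < 1 ->
  1 <= c -> c ^+ 2 < 2 * rho / (1 - rho) -> (c%:E <= Psi rho)%E.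
Proof.
move=> rho01 c1 crho; have /andP[r0 r1] := rho01.
have c0 : 0 < c by exact: lt_le_trans c1.
have c20 : 0 < c ^+ 2 by rewrite exprn_gt0.
have c21 : 1 <= c ^+ 2 by rewrite exprn_ege1.
(* Two further coordinates share the remaining weight equally. From 1 <= c one gets al <= 1 and rho
   > 1/3, whence be <= 1. *)
pose al := (c ^+ 2)^-1; pose be := (rho^-1 - al) / 2.
have al1 : al <= 1 by rewrite invf_le1.
have r1' : 0 < 1 - rho by rewrite subr_gt0.
have alr : 1 - rho < 2 * rho * al.
  by rewrite /al ltr_pdivlMr// mulrC -ltr_pdivlMr.
have ir : rho * rho^-1 = 1 by rewrite mulfV// gt_eqF.
pose w : 'cV[R]_3 := \col_i (if i == 0 then al else be).
have w0 : w 0 0 = al by rewrite mxE eqxx.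
have ws : \sum_i w i 0 = rho^-1.
  by rewrite !big_ord_recl big_ord0 !mxE/= /be; field; rewrite gt_eqF.
have r10 : 0 < 1 + rho by rewrite addr_gt0.
have wi i : (1 - rho) / (1 + rho) <= w i 0 <= 1.
  rewrite mxE ler_pdivrMr//; case: ifP => _; first by apply/andP; split; nra.
  have beE : rho * be = (1 - rho * al) / 2 by rewrite /be mulrA mulrBr ir.
  have ral : rho * al <= rho by rewrite ler_piMr// ltW.
  apply/andP; split; rewrite -(ler_pM2l r0); last by rewrite beE; lra.
  by rewrite [leRHS](mulrA rho be) beE; nra.
have wpos i : 0 <= w i 0.
  by have /andP[+ _] := wi i; apply: le_trans; rewrite divr_ge0// ltW.
have wr : (1 - rho) / rho < 2 * w 0 0 by rewrite w0 ltr_pdivrMr// mulrAC.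
have [a0 a00 gap] := face_gap_capped rho01 c0 ws wpos w0 wr.
exact: Psi_ge (property_beta_capped rho01 ws wi) (PsiXY_ge c0 a00 gap).
Qed.

Theorem theorem3p11 (R : realType) (rho : R) (rho_gt0 : 0 < rho)
    (rho_lt1 : rho < 1) :
  ((Num.max (Num.sqrt (2 * rho / (1 - rho))) 1)%:E <= Psi rho)%E.
Proof.
have rho01 : 0 < rho < 1 by rewrite rho_gt0.
have [_|s1] := leP (Num.sqrt (2 * rho / (1 - rho))) 1; first exact: Psi_ge1.
(* [Psi_ge_sqr] needs a strict inequality, so the square root is approached from below. *)
apply/lee_subgt0Pr => e e0; rewrite -EFinB.
set c := _ - e; have [c1|/ltW c1] := leP c 1.
  by apply: le_trans (Psi_ge1 rho01); rewrite lee_fin.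
apply: Psi_ge_sqr => //; rewrite -[ltRHS]sqr_sqrtr; last first.
  by rewrite divr_ge0 ?subr_ge0 ?mulr_ge0// ltW.
by rewrite ltr_pXn2r ?nnegrE ?sqrtr_ge0 ?(le_trans ler01)// ltrBlDr ltrDl.
Qed.
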